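(* Let $d\ge1$, let $\mathcal{S}$ be a set, let $(M,\varrho_M)$ be a complete metric space, and let $X=(X_s(x))$, $(s,x)\in\mathcal{S}\times[0,1]^d$, be a process on a probability space $(\Omega,\mathcal{F},P)$ with values in $M$ which is continuous with respect to $x$. Assume that for some $a,b>0$ $$\sup_{s\in\mathcal{S}}\mathbb{E}\,\varrho_M(X_s(u),X_s(v))^{a}\le|u-v|^{d+b},\qquad u,v\in[0,1]^d .$$ Then for any $\alpha\in(0,b/a)$, any $\eta\in(0,b-\alpha a)$ and any increasing sequence $S=\{S_n\}_{n=0}^\infty$ of finite subsets of $\mathcal{S}$ with $|S_n|\le2^{\eta n}$ for all $n$, there exist a set $\Omega'$ of probability $1$ and a finite constant $C(\alpha,\eta,S,\omega)$ for each $\omega\in\Omega'$ such that for every $\omega\in\Omega'$, every $n\ge0$, every $s\in S_n$ and all $u,v\in[0,1]^d$ with $|u-v|\le2^{-n}$, $$\varrho_M(X_s(u)(\omega),X_s(v)(\omega))\le C(\alpha,\eta,S,\omega)\,|u-v|^{\alpha}.$$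
   Context: $|S_n|$ denotes the number of elements of the finite set $S_n$, and ''increasing'' means $S_n\subseteq S_{n+1}$ for all $n$. Continuity with respect to $x$ means that for each $s\in\mathcal{S}$ the map $x\mapsto X_s(x)$ is continuous on $[0,1]^d$. No structure on the index set $\mathcal{S}$ and no regularity in $s$ is assumed. *)

(* Defs.v *)
From HB Require Import structures.
From mathcomp Require Export all_boot all_order all_algebra finmap.
From mathcomp Require Export all_classical all_reals all_analysis.
Set Implicit Arguments.
Unset Strict Implicit.
Unset Printing Implicit Defensive.
Import Order.TTheory GRing.Theory Num.Theory.
Import numFieldNormedType.Exports.
Local Open Scope classical_set_scope.
Local Open Scope ring_scope.

(* [Complete] includes [Pointed], so these spaces are nonempty. *)
#[short(type="completeMetricType")]
HB.structure Definition CompleteMetric (R : numDomainType) :=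
  {M of Complete M & Metric R M}.

(* The library norm on ['rV[R]_d] is the sup norm, hence this definition;
   both norms induce the same topology. *)
Definition enorm (R : realType) (d : nat) (x : 'rV[R]_d) : R :=
  Num.sqrt (\sum_(i < d) x ord0 i ^+ 2).

Definition unit_cube (R : realType) (d : nat) : set 'rV[R]_d :=
  [set x | forall i : 'I_d, 0 <= x ord0 i <= 1].

Arguments unit_cube : clear implicits.

(* Main.v *)
Require Import Defs.
From mathcomp Require Import all_boot all_order all_algebra finmap.
From mathcomp Require Import all_classical all_reals all_analysis.
From mathcomp Require Import measurable_realfun zify ring lra.
Import Order.TTheory GRing.Theory Num.Theory.
Import numFieldNormedType.Exports.
Local Open Scope classical_set_scope.
Local Open Scope ring_scope.

(** The argument is Kolmogorov's dyadic chaining, made uniform over the growing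
    sets [S n].

    At scale [n], consider all pairs of adjacent points of the grid of mesh
    [2 ^- n], that is, points each of whose coordinates differ by at most one
    mesh.  There are at most [6 ^ d * 2 ^ (d n)] such pairs
    ([card_adjacent_pairs]) and at most [2 ^ (eta n)] indices in [S n], while
    each [a]-th moment of an increment is at most a constant times
    [2 ^ - (d + b) n].  Weighting the sum of all these [a]-th powers by
    [2 ^ (alpha a n)] gives random variables whose expectations are bounded by
    [c * rho ^ n] with [rho = 2 ^ (alpha a + eta - b) < 1]
    ([total_moment]); this is where [eta < b - alpha a] enters.  Their sum over
    [n] has finite expectation, hence is finite almost surely
    ([almost_sure_bound]), and its [a]-th root [K] bounds every increment of
    [X s], [s] in [S n], over adjacent points at scale [n] by
    [K * 2 ^ (- alpha n)] ([dyadic_increments]).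

    The rest is deterministic.  Let [s] belong to [S n], let [u] and [v] be
    distinct points at distance at most [2 ^- n], and choose [m >= n] with
    [2 ^- (m + 1) < |u - v| <= 2 ^- m].  The points obtained by rounding [u]
    down to the grids of mesh [2 ^- k], [k >= m], form a chain of adjacent
    points converging to [u]; likewise for [v]; and the two chains start at
    adjacent points.  Since the sets increase, [s] is in [S k] for every
    [k >= m], so the bounds at all these scales apply to [X s].  Summing the
    geometric series and using continuity at [u] and [v] yields
    [K * 2 ^ (- alpha m)] up to a constant ([chaining]), which is comparable
    to [K * |u - v| ^ alpha]. *)

(** * Euclidean norm and dyadic grids *)

Section EuclideanNorm.
Context {R : realType} {d : nat}.
Implicit Types (x : 'rV[R]_d) (c : R).

Lemma enorm_ge0 x : 0 <= enorm x.
Proof. exact: sqrtr_ge0. Qed.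

Lemma coord_le_enorm x i : `|x ord0 i| <= enorm x.
Proof.
rewrite -sqrtr_sqr; apply: ler_wsqrtr.
by rewrite (bigD1 i)//= lerDl sumr_ge0// => j _; exact: sqr_ge0.
Qed.

Lemma enorm_le_coord x c : 0 <= c -> (forall i, `|x ord0 i| <= c) ->
  enorm x <= Num.sqrt d%:R * c.
Proof.
move=> c0 xc; rewrite -[X in _ * X](ger0_norm c0) -sqrtr_sqr -sqrtrM//.
apply: ler_wsqrtr; apply: (@le_trans _ _ (\sum_(i < d) c ^+ 2)).
  apply: ler_sum => i _; rewrite -[leLHS]real_normK ?num_real//.
  by rewrite lerXn2r ?nnegrE.
by rewrite sumr_const card_ord mulr_natl.
Qed.

End EuclideanNorm.

Section DyadicGrid.
Context {R : realType} {d : nat}.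
Implicit Types (x : 'rV[R]_d) (p q : 'I_d -> nat).

Definition grid n p : 'rV[R]_d := \row_i ((p i)%:R / 2 ^+ n).

(** Diagonal neighbours and equal points are included: rounding two close
    points, or one point at two successive scales, may change every coordinate. *)
Definition adjacent p q := [forall i, (p i <= (q i).+1)%N && (q i <= (p i).+1)%N].

Definition floor_index n x : 'I_d -> nat :=
  fun i => Num.truncn (2 ^+ n * x ord0 i).

Lemma grid_unit_cube n p : (forall i, (p i <= 2 ^ n)%N) ->
  unit_cube R d (grid n p).
Proof.
move=> pn i; rewrite mxE divr_ge0 ?exprn_ge0//= ler_pdivrMr ?exprn_gt0//.
by rewrite mul1r -natrX ler_nat.
Qed.

Lemma dist_adjacent n p q : adjacent p q ->
  forall i, `|(grid n p - grid n q) ord0 i| <= 2 ^- n.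
Proof.
move=> /forallP pq i; have /andP[pq1 qp1] := pq i.
rewrite !mxE -mulrBl normrM (@ger0_norm _ (_ ^- _)) ?invr_ge0 ?exprn_ge0//.
rewrite ler_piMl ?invr_ge0 ?exprn_ge0// ler_norml.
move: pq1 qp1; rewrite -!(ler_nat R) -!natr1; lra.
Qed.

Lemma floor_index_itv n x i : unit_cube R d x ->
  (floor_index n x i)%:R <= 2 ^+ n * x ord0 i < (floor_index n x i)%:R + 1.
Proof.
move=> /(_ i) /andP[x0 _].
by have := @truncn_itv R _ (mulr_ge0 (exprn_ge0 n (ler0n R 2)) x0);
  rewrite -[_%:R in X in _ < X]natr1.
Qed.

Lemma floor_index_le n x i : unit_cube R d x -> (floor_index n x i <= 2 ^ n)%N.
Proof.
move=> xc; have /andP[+ _] := floor_index_itv n x i xc.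
rewrite -(ler_nat R) natrX => /le_trans; apply.
by rewrite ler_piMr ?exprn_ge0//; case/andP: (xc i).
Qed.

Lemma dist_grid_floor n x i : unit_cube R d x ->
  `|(x - grid n (floor_index n x)) ord0 i| <= 2 ^- n.
Proof.
move=> xc; have := floor_index_itv n x i xc.
rewrite !mxE; set t := (floor_index n x i)%:R; set y := x ord0 i => H.
have e0 : 0 < 2 ^+ n :> R by rewrite exprn_gt0.
have -> : y - t / 2 ^+ n = (2 ^+ n * y - t) / 2 ^+ n.
  by rewrite mulrBl mulrAC mulfV ?gt_eqF// mul1r.
rewrite normrM (@ger0_norm _ (_ ^- _)) ?invr_ge0 ?exprn_ge0//.
by rewrite ler_piMl ?invr_ge0 ?exprn_ge0// ler_norml; lra.
Qed.

(** Reals at distance at most one have integer parts differing by at most one. *)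
Lemma adjacent_floor n x y : unit_cube R d x -> unit_cube R d y ->
  (forall i, `|(x - y) ord0 i| <= 2 ^- n) ->
  adjacent (floor_index n x) (floor_index n y).
Proof.
move=> xc yc xy; apply/forallP => i.
have := floor_index_itv n x i xc; have := floor_index_itv n y i yc.
have e0 : 0 < 2 ^+ n :> R by rewrite exprn_gt0.
have : `|2 ^+ n * x ord0 i - 2 ^+ n * y ord0 i| <= 1.
  rewrite -mulrBr normrM (gtr0_norm e0) mulrC -ler_pdivlMr// mul1r.
  by have := xy i; rewrite !mxE.
rewrite ler_norml => h1 h2 h3.
by apply/andP; split; rewrite -ltnS -(ltr_nat R) -[_.+2%:R]natr1 -[_.+1%:R]natr1; lra.
Qed.

Lemma grid_refine n p : grid n p = grid n.+1 (fun i => (p i).*2)%N.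
Proof.
apply/rowP => i; rewrite !mxE exprS invfM mulrA -muln2 natrM mulfK//.
Qed.

(** The point rounded down at mesh [2 ^- n] has even indices on the grid of mesh
    [2 ^- n.+1], and refining the rounding adds [0] or [1] to each of them. *)
Lemma adjacent_floor_refine n x : unit_cube R d x ->
  adjacent (fun i => (floor_index n x i).*2)%N (floor_index n.+1 x).
Proof.
move=> xc; apply/forallP => i.
have := floor_index_itv n x i xc; have := floor_index_itv n.+1 x i xc.
rewrite exprS -mulrA; set u := floor_index n.+1 x i; set v := floor_index n x i.
move=> H1 H2.
have h1 : u%:R < (v.+1).*2%:R :> R by rewrite -mul2n natrM -[v.+1%:R]natr1; lra.
have h2 : (v.*2)%:R < u.+1%:R :> R by rewrite -mul2n natrM -[u.+1%:R]natr1; lra.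
by move: h1 h2; rewrite !ltr_nat; lia.
Qed.

End DyadicGrid.

(** Taking the least admissible [m] gives the upper bound, either from the
    minimality or, when [m = n], from the hypothesis. *)
Lemma dyadic_scale (R : realType) (t : R) n : 0 < t -> t <= 2 ^- n ->
  exists m, [/\ (n <= m)%N, 2 ^- m.+1 < t & t <= 2 ^- m].
Proof.
move=> t0 tn.
have ex : exists m, (n <= m)%N && (2 ^- m.+1 < t).
  exists (n + Num.truncn t^-1)%N; rewrite leq_addr/= invf_plt ?posrE ?exprn_gt0//.
  apply: lt_le_trans (truncnS_gt _) _; rewrite -natrX ler_nat.
  apply: leq_trans (ltn_expl _ (isT : (1 < 2)%N)) _.
  by rewrite leq_exp2l// leqW// leq_addl.
exists (ex_minn ex); case: ex_minnP => m /andP[nm mt] mmin; split => //.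
move: nm; rewrite leq_eqVlt => /predU1P[<-//|].
case: m mt mmin => [//|m] mt mmin nm; rewrite leNgt; apply/negP => tm.
by have := mmin m; rewrite -ltnS nm tm/= ltnn => /(_ isT).
Qed.

(** * Chaining along dyadic grids *)

Section Chaining.
Context {R : realType} {d : nat} {M : metricType R}.
Variables (f : 'rV[R]_d -> M) (K r : R) (m : nat).
Hypotheses (f_cont : {within unit_cube R d, continuous f})
  (K0 : 0 <= K) (r0 : 0 <= r) (r1 : r < 1).
Hypothesis increments : forall k p q, (m <= k)%N ->
  (forall i, (p i <= 2 ^ k)%N) -> (forall i, (q i <= 2 ^ k)%N) ->
  adjacent p q -> mdist (f (grid k p)) (f (grid k q)) <= K * r ^+ k.

Let fl k (x : 'rV[R]_d) : 'rV[R]_d := grid k (floor_index k x).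

Lemma mdist_floor_step k x : (m <= k)%N -> unit_cube R d x ->
  mdist (f (fl k x)) (f (fl k.+1 x)) <= K * r ^+ k.+1.
Proof.
move=> mk xc; rewrite /fl [grid k _]grid_refine; apply: increments.
- exact: leqW.
- by move=> i; rewrite expnS mul2n leq_double floor_index_le.
- by move=> i; exact: floor_index_le.
- exact: adjacent_floor_refine.
Qed.

Lemma mdist_floor_iter j x : unit_cube R d x ->
  mdist (f (fl m x)) (f (fl (m + j) x)) <= K * r ^+ m * (1 - r ^+ j) / (1 - r).
Proof.
move=> xc; have s0 : 0 < 1 - r by rewrite subr_gt0.
(* The bound is the partial sum of the geometric series from [m.+1] to
   [m + j], its leading factor [r ^+ m.+1] being relaxed to [r ^+ m]. *)
elim: j => [|j IH].
  by rewrite addn0 mdistxx expr0 subrr mulr0 mul0r.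
rewrite addnS; apply: le_trans (metric_triangle _ (f (fl (m + j) x)) _) _.
apply: le_trans (lerD IH (mdist_floor_step _ _ (leq_addr _ _) xc)) _.
have -> : K * r ^+ m * (1 - r ^+ j.+1) / (1 - r) =
   K * r ^+ m * (1 - r ^+ j) / (1 - r) + K * (r ^+ m * r ^+ j).
  by rewrite exprS; field; rewrite gt_eqF.
rewrite lerD2l ler_wpM2l// -exprD; apply: ler_wiXn2l => //; exact: ltW.
Qed.

(** The only use of continuity: the roundings of [x] converge to [x], so the
    values of [f] along the chain come arbitrarily close to [f x]. *)
Lemma floor_cvg x : unit_cube R d x -> forall e, 0 < e ->
  exists j, mdist (f x) (f (fl (m + j) x)) < e.
Proof.
move=> xc e e0.
have : \forall y \near within (unit_cube R d) (nbhs x), mdist (f x) (f y) < e.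
  have := f_cont x; rewrite /continuous_at/= => /cvg_ballP/(_ e e0).
  rewrite /= ballEmdist /= => H; rewrite nbhs_subspace_in//.
move=> /nbhs_ballP[/= del del0 hdel].
have [j jd] : exists j, 2 ^- (m + j) < del.
  exists (Num.truncn del^-1); rewrite invf_plt ?posrE ?exprn_gt0//.
  apply: lt_le_trans (truncnS_gt _) _; rewrite -natrX ler_nat.
  by apply: leq_trans (ltn_expl _ (isT : (1 < 2)%N)) _; rewrite leq_exp2l// leq_addl.
exists j; apply: hdel; last by apply: grid_unit_cube => i; exact: floor_index_le.
split=> // i k; rewrite ord1 /ball/=; apply: le_lt_trans jd.
by have := dist_grid_floor (m + j) x k xc; rewrite !mxE.
Qed.

Lemma mdist_floor_limit x : unit_cube R d x ->
  mdist (f (fl m x)) (f x) <= K * r ^+ m / (1 - r).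
Proof.
move=> xc; have s0 : 0 < 1 - r by rewrite subr_gt0.
apply/ler_addgt0Pr => e e0.
have [j /ltW fj] := floor_cvg _ xc _ e0.
apply: le_trans (metric_triangle _ (f (fl (m + j) x)) _) _.
rewrite [mdist _ (f x)]metric_sym; apply: lerD fj.
apply: le_trans (mdist_floor_iter _ _ xc) _.
rewrite ler_wpM2r ?invr_ge0 ?(ltW s0)// ler_piMr ?mulr_ge0 ?exprn_ge0//.
by rewrite gerBl exprn_ge0.
Qed.

(** The term [1] accounts for the jump between the two chains at scale [m], the
    term [2 / (1 - r)] for following each chain to its limit. *)
Lemma chaining x y : unit_cube R d x -> unit_cube R d y ->
  (forall i, `|(x - y) ord0 i| <= 2 ^- m) ->
  mdist (f x) (f y) <= K * r ^+ m * (1 + 2 / (1 - r)).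
Proof.
move=> xc yc xy.
apply: le_trans (metric_triangle _ (f (fl m x)) _) _.
apply: (@le_trans _ _ (K * r ^+ m / (1 - r) + (K * r ^+ m + K * r ^+ m / (1 - r)))).
  apply: lerD; first by rewrite metric_sym mdist_floor_limit.
  apply: le_trans (metric_triangle _ (f (fl m y)) _) _.
  apply: lerD; last exact: mdist_floor_limit.
  apply: increments => //.
  - by move=> i; exact: floor_index_le.
  - by move=> i; exact: floor_index_le.
  - exact: adjacent_floor.
by rewrite le_eqVlt; apply/orP; left; apply/eqP; field; rewrite gt_eqF// subr_gt0.
Qed.

End Chaining.

(** * Powers of two with real exponents *)

Lemma powR2_exprn (R : realType) (x : R) n : 2 `^ (x * n%:R) = (2 `^ x) ^+ n.
Proof. by rewrite powRrM powR_mulrn// powR_ge0. Qed.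

Lemma powR_exprn (R : realType) (x y : R) n : 0 <= x -> (x ^+ n) `^ y = (x `^ y) ^+ n.
Proof.
by move=> x0; rewrite -powR_mulrn// -powRrM mulrC powRrM powR_mulrn// powR_ge0.
Qed.

Lemma powR2_invX (R : realType) (x : R) n : (2 ^- n) `^ x = (2 `^ - x) ^+ n.
Proof. by rewrite -exprVn powR_exprn ?invr_ge0// -powR_inv1// -powRrM mulN1r. Qed.

Lemma powR2_lt1 (R : realType) (x : R) : x < 0 -> 2 `^ x < 1.
Proof.
move=> x0; rewrite /powR pnatr_eq0/= -[ltRHS]expR0 ltr_expR nmulr_rlt0// ln_gt0//.
by rewrite ltr1n.
Qed.

(** * Bounds on expectations *)

Section AlmostSureBound.
Context {disp : measure_display} {Omega : measurableType disp} {R : realType}.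
Variable P : probability Omega R.
Variables (F : nat -> Omega -> R) (c rho : R).
Hypotheses (F_meas : forall n, measurable_fun setT (F n))
  (F0 : forall n w, 0 <= F n w) (c0 : 0 <= c) (rho0 : 0 < rho) (rho1 : rho < 1).
Hypothesis F_int : forall n, (\int[P]_w (F n w)%:E <= (c * rho ^+ n)%:E)%E.

(** The series of the [F n] has expectation at most [c / (1 - rho)], so it is
    finite almost surely; being a sum of nonnegative terms, it dominates each
    of them. *)
Lemma almost_sure_bound : exists (Omega' : set Omega) (C : Omega -> R),
  [/\ measurable Omega', P Omega' = 1%E &
      forall w, Omega' w -> forall n, F n w <= C w].
Proof.
pose T : Omega -> \bar R := fun w => (\sum_(0 <= n <oo) (F n w)%:E)%E.
have T0 w : (0 <= T w)%E by apply: nneseries_ge0 => n _ _; rewrite lee_fin.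
have mF n : measurable_fun setT (EFin \o F n) by exact/measurable_EFinP.
have mT : measurable_fun setT T.
  exact: (@ge0_emeasurable_sum _ _ _ _ (fun n w => (F n w)%:E) xpredT
    (fun n w _ _ => F0 n w) (fun n _ => mF n)).
have intT : (\int[P]_w T w <= (c / (1 - rho))%:E)%E.
  rewrite integral_nneseries//; last by move=> n w _; rewrite lee_fin.
  apply: lime_le.
    by apply: is_cvg_nneseries => n _ _; apply: integral_ge0 => w _; rewrite lee_fin.
  near=> N; apply: (@le_trans _ _ (\sum_(0 <= n < N) (c * rho ^+ n)%:E)%E).
    by apply: lee_sum => n _; exact: F_int.
  rewrite sumEFin lee_fin; apply: geometric_le_lim => //.
  by rewrite gtr0_norm.
have iT : P.-integrable setT T.
  apply/integrableP; split => //.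
  under eq_integral => w _ do rewrite gee0_abs//.
  exact: le_lt_trans intT (ltry _).
have mO : measurable [set w | (T w < +oo)%E].
  by rewrite -[X in measurable X]setTI; exact: emeasurable_fun_infty_o.
exists [set w | (T w < +oo)%E], (fun w => fine (T w)); split => //.
- have [A [mA PA0 hA]] := integrable_ae measurableT iT.
  have P0 : P (~` [set w | (T w < +oo)%E]) = 0%E.
    apply: (subset_measure0 _ _ _ PA0) => //; first exact: measurableC.
    move=> w /= Tw; apply: hA => /= /(_ Logic.I) Tfin; apply: Tw.
    by rewrite ltey_eq Tfin.
  by rewrite -[X in P X]setCK probability_setC ?P0 ?sube0//; exact: measurableC.
- move=> w /= Tw n.
  have Tfin : T w \is a fin_num by rewrite ge0_fin_numE.
  rewrite -lee_fin fineK//.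
  apply: le_trans (nneseries_lim_ge n.+1 _); last by move=> k _ _; rewrite lee_fin.
  rewrite big_nat_recr//= leeDr// sume_ge0// => k _; by rewrite lee_fin.
Unshelve. all: by end_near. Qed.

End AlmostSureBound.

Lemma integral_sum_le {disp} {Omega : measurableType disp} {R : realType}
    (P : probability Omega R) (Z : eqType) (L : seq Z) (G : Z -> Omega -> R) (B : R) :
  (forall z, measurable_fun setT (G z)) -> (forall z w, 0 <= G z w) ->
  (forall z, z \in L -> (\int[P]_w (G z w)%:E <= B%:E)%E) ->
  (\int[P]_w (\sum_(z <- L) G z w)%:E <= ((size L)%:R * B)%:E)%E.
Proof.
move=> mG G0 GB.
under eq_integral => w _ do rewrite -sumEFin.
rewrite ge0_integral_sum//; first last.
- by move=> z w _; rewrite lee_fin.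
- by move=> z; exact/measurable_EFinP.
apply: (@le_trans _ _ (\sum_(z <- L) B%:E)%E).
  by rewrite big_seq [leRHS]big_seq; apply: lee_sum => z; exact: GB.
by rewrite sumEFin big_const_seq count_predT iter_addr_0 mulr_natl.
Qed.

(** * Increments over adjacent grid points *)

Section AdjacentPairs.
Context {d : nat}.

Definition grid_index n := {ffun 'I_d -> 'I_(2 ^ n).+1}.

Definition index_fun n (p : grid_index n) : 'I_d -> nat := fun i => p i.

Definition adjacent_pairs n : {set grid_index n * grid_index n} :=
  [set pq | adjacent (index_fun n pq.1) (index_fun n pq.2)].

(** There are [(2 ^ n).+1 ^ d <= 2 ^ d * (2 ^ d) ^ n] choices for the first point,
    and then each coordinate of the second one takes at most three values. *)
Lemma card_adjacent_pairs n : (#|adjacent_pairs n| <= 6 ^ d * (2 ^ d) ^ n)%N.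
Proof.
(* The successor keeps the truncated subtraction from identifying two of the
   three offsets, which become [0], [1] and [2]. *)
pose enc (pq : grid_index n * grid_index n) : grid_index n * {ffun 'I_d -> 'I_3} :=
  (pq.1, [ffun i => inord ((pq.2 i).+1 - pq.1 i)]).
have inj : {in adjacent_pairs n &, injective enc}.
  move=> [p q] [p' q']; rewrite !inE => /forallP pq /forallP pq'.
  move=> [pp' /ffunP qq]; subst p'.
  congr pair; apply/ffunP => i; apply: val_inj.
  have := congr1 val (qq i); rewrite !ffunE /=.
  have := pq i; have := pq' i; rewrite /index_fun /=.
  case: (p i) (q i) (q' i) => [a ha] [b hb] [c hc] /= /andP[h1 h2] /andP[h3 h4].
  by rewrite !inordK; lia.
rewrite -(card_in_imset inj); apply: leq_trans (max_card _) _.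
rewrite card_prod !card_ffun !card_ord -expnM [(d * n)%N]mulnC expnM -!expnMn.
have : ((2 ^ n).+1 * 3 <= 6 * 2 ^ n)%N by have := expn_gt0 2 n; lia.
by case: d => [|d'] H; rewrite ?expn0// leq_exp2r.
Qed.

End AdjacentPairs.

Section DyadicIncrements.
Context {R : realType} {d : nat} {I : choiceType} {M : metricType R}
  {disp : measure_display} {Omega : measurableType disp}.
Variables (P : probability Omega R) (X : I -> 'rV[R]_d -> Omega -> M).
Variables (a b alpha eta : R) (S : nat -> {fset I}).
Hypotheses (a0 : 0 < a) (b0 : 0 < b) (eta_lt : eta < b - alpha * a).
Hypothesis dist_measurable : forall s u v,
  unit_cube R d u -> unit_cube R d v ->
  measurable_fun setT (fun w => mdist (X s u w) (X s v w)).
Hypothesis moment : forall s u v, unit_cube R d u -> unit_cube R d v ->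
  (\int[P]_w (mdist (X s u w) (X s v w) `^ a)%:E
   <= (enorm (u - v) `^ (d%:R + b))%:E)%E.
Hypothesis card_S : forall n, (#|` S n|)%:R <= 2 `^ (eta * n%:R) :> R.

Definition grid_pairs n :=
  [seq (s, pq) | s <- enum_fset (S n), pq <- enum (adjacent_pairs (d := d) n)].

Definition increment n (z : I * (grid_index (d := d) n * grid_index n)) w :=
  mdist (X z.1 (grid n (index_fun n z.2.1)) w) (X z.1 (grid n (index_fun n z.2.2)) w).

Lemma grid_index_unit_cube n (p : grid_index (d := d) n) :
  unit_cube R d (grid n (index_fun n p)).
Proof. by apply: grid_unit_cube => i; rewrite -ltnS ltn_ord. Qed.

Lemma size_grid_pairs n :
  (size (grid_pairs n))%:R <= (6 ^ d)%:R * ((2 `^ eta * 2 `^ d%:R) ^+ n) :> R.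
Proof.
rewrite size_allpairs -cardE natrM exprMn mulrCA.
apply: ler_pM => //; first by rewrite -powR2_exprn.
by rewrite powR_mulrn// -natrX -natrX -natrM ler_nat card_adjacent_pairs.
Qed.

(** Adjacent points are at Euclidean distance at most [sqrt d * 2 ^- n]. *)
Lemma increment_moment n z : z \in grid_pairs n ->
  (\int[P]_w (increment n z w `^ a)%:E
   <= (Num.sqrt d%:R `^ (d%:R + b) * (2 `^ - (d%:R + b)) ^+ n)%:E)%E.
Proof.
case/allpairsP => -[s [p q]] /= [_ + ->]; rewrite mem_enum inE => /= pq.
apply: le_trans (moment _ _ _ (grid_index_unit_cube _ _) (grid_index_unit_cube _ _)) _.
have db0 : 0 <= d%:R + b by rewrite addr_ge0// ltW.
rewrite lee_fin -powR2_invX -powRM ?invr_ge0 ?exprn_ge0//.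
apply: ge0_ler_powR; rewrite ?nnegrE ?enorm_ge0 ?mulr_ge0 ?invr_ge0
  ?exprn_ge0 ?sqrtr_ge0//.
apply: enorm_le_coord; first by rewrite invr_ge0 exprn_ge0.
exact: dist_adjacent.
Qed.

Let scale : R := 2 `^ (alpha * a).

(** The weight is what turns a bound on [total] uniform in [n] into a bound of
    order [2 ^ (- alpha n)] on each increment. *)
Let total n w := scale ^+ n * \sum_(z <- grid_pairs n) increment n z w `^ a.

Let rate := 2 `^ (alpha * a + eta - b).

(** The factors are, in order, the weight, the growth of [S n], the growth of the
    grid and the decay of the moments; the dimension cancels. *)
Lemma rateE : rate = scale * (2 `^ eta * 2 `^ d%:R) * 2 `^ - (d%:R + b).
Proof.
rewrite /rate /scale -!powRD ?pnatr_eq0 ?implybT//; congr (_ `^ _); ring.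
Qed.

Lemma measurable_increment n z : measurable_fun setT (fun w => increment n z w `^ a).
Proof.
apply: (measurableT_comp (f := fun t : R => t `^ a)); first exact: measurable_powR.
by apply: dist_measurable; exact: grid_index_unit_cube.
Qed.

Lemma total_moment n : (\int[P]_w (total n w)%:E <=
  (((6 ^ d)%:R * Num.sqrt d%:R `^ (d%:R + b)) * rate ^+ n)%:E)%E.
Proof.
have sc0 : 0 <= scale ^+ n by rewrite exprn_ge0// powR_ge0.
under eq_integral => w _ do rewrite EFinM.
rewrite ge0_integralZl_EFin//; first last.
- by apply/measurable_EFinP; apply: measurable_sum => z; exact: measurable_increment.
- by move=> w _; rewrite lee_fin sumr_ge0// => z _; exact: powR_ge0.
apply: (le_trans (lee_wpmul2l _ (integral_sum_le P _ _ _ _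
  (measurable_increment n) _ (increment_moment n)))).
- by rewrite lee_fin.
- by move=> z w; exact: powR_ge0.
rewrite -EFinM lee_fin rateE [(scale * _ * _) ^+ n]exprMn [(scale * _) ^+ n]exprMn.
set D := Num.sqrt _ `^ _; set q := (2 `^ - _) ^+ n; set N := (size _)%:R.
have D0 : 0 <= D by exact: powR_ge0.
have q0 : 0 <= q by rewrite exprn_ge0// powR_ge0.
have := size_grid_pairs n; rewrite -/N; set N' := _ ^+ n => NN.
apply: (@le_trans _ _ (scale ^+ n * ((6 ^ d)%:R * N' * (D * q)))).
  by rewrite ler_wpM2l// ler_wpM2r// mulr_ge0.
by rewrite le_eqVlt; apply/orP; left; apply/eqP; ring.
Qed.

(** An almost sure bound on [total n] bounds each of its nonnegative summands;
    dividing by the weight and extracting the [a]-th root isolates one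
    increment. *)
Lemma dyadic_increments : exists (Omega' : set Omega) (K : Omega -> R),
  [/\ measurable Omega', P Omega' = 1%E &
    forall w, Omega' w -> 0 <= K w /\
    forall n s p q, s \in S n ->
      (forall i, (p i <= 2 ^ n)%N) -> (forall i, (q i <= 2 ^ n)%N) ->
      adjacent p q ->
      mdist (X s (grid n p) w) (X s (grid n q) w) <= K w * (2 `^ - alpha) ^+ n].
Proof.
have total_ge0 n w : 0 <= total n w.
  by rewrite mulr_ge0 ?exprn_ge0 ?powR_ge0// sumr_ge0// => z _; exact: powR_ge0.
have mtotal n : measurable_fun setT (total n).
  apply: measurable_funM => //.
  by apply: measurable_sum => z; exact: measurable_increment.
have [|||Omega' [C [mO PO HC]]] :=
    almost_sure_bound P total _ rate mtotal total_ge0 _ _ _ total_moment.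
- by rewrite mulr_ge0// powR_ge0.
- by rewrite powR_gt0.
- by apply: powR2_lt1; move: eta_lt; lra.
exists Omega', (fun w => C w `^ a^-1); split => // w wO; split; first exact: powR_ge0.
move=> n s p q sS pn qn pq.
pose ip : grid_index (d := d) n := [ffun i => inord (p i)].
pose iq : grid_index (d := d) n := [ffun i => inord (q i)].
have ipE : index_fun n ip = p.
  by apply/funext => i; rewrite /index_fun ffunE inordK// ltnS.
have iqE : index_fun n iq = q.
  by apply/funext => i; rewrite /index_fun ffunE inordK// ltnS.
have zin : (s, (ip, iq)) \in grid_pairs n.
  by apply: allpairs_f => //; rewrite mem_enum inE/= ipE iqE.
have sc0 : 0 < scale ^+ n by rewrite exprn_gt0// powR_gt0.
set D := mdist _ _.
have D0 : 0 <= D by exact: mdist_ge0.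
have DC : scale ^+ n * D `^ a <= C w.
  apply: le_trans (HC w wO n); rewrite ler_wpM2l ?(ltW sc0)//.
  have -> : D = increment n (s, (ip, iq)) w by rewrite /increment/= ipE iqE.
  rewrite (big_rem _ zin)/= lerDl sumr_ge0// => z _; exact: powR_ge0.
have C0 : 0 <= C w by apply: le_trans DC; rewrite mulr_ge0 ?powR_ge0// ltW.
have aV0 : 0 <= a^-1 by rewrite invr_ge0 ltW.
have -> : D = (D `^ a) `^ a^-1 by rewrite -powRrM mulfV ?gt_eqF// powRr1.
have -> : (2 `^ - alpha) ^+ n = (scale ^- n) `^ a^-1.
  rewrite -exprVn powR_exprn ?invr_ge0 ?powR_ge0//; congr (_ ^+ n).
  by rewrite /scale -powRN -powRrM -mulNr mulfK ?gt_eqF.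
rewrite -powRM ?invr_ge0 ?(ltW sc0)//.
apply: ge0_ler_powR; rewrite ?nnegrE ?mulr_ge0 ?invr_ge0 ?powR_ge0 ?(ltW sc0) ?(ltW a0)//.
by rewrite ler_pdivlMr// mulrC.
Qed.

End DyadicIncrements.

(** * The uniform modulus of continuity *)

Theorem lemma2p1 (R : realType) (d : nat) (hd : (1 <= d)%N)
  (I : choiceType) (M : completeMetricType R)
  (disp : measure_display) (Omega : measurableType disp)
  (P : probability Omega R)
  (X : I -> 'rV[R]_d -> Omega -> M)
  (X_measurable : forall (s : I) (x : 'rV[R]_d), unit_cube R d x ->
    measurable_fun [set: Omega]
      (X s x : Omega -> g_sigma_algebraType (@open M)))
  (dist_measurable : forall (s : I) (u v : 'rV[R]_d),
    unit_cube R d u -> unit_cube R d v ->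
    measurable_fun [set: Omega] (fun w => mdist (X s u w) (X s v w)))
  (X_continuous : forall (s : I) (w : Omega),
    {within unit_cube R d, continuous (fun x => X s x w)})
  (a b : R) (ha : 0 < a) (hb : 0 < b)
  (hX : forall u v : 'rV[R]_d, unit_cube R d u -> unit_cube R d v ->
    (ereal_sup [set 'E_P[fun w => (mdist (X s u w) (X s v w) `^ a)%R]
                | s in [set: I]]
     <= (enorm (u - v) `^ (d%:R + b))%:E)%E) :
  forall (alpha eta : R) (S : nat -> {fset I}),
    0 < alpha < b / a ->
    0 < eta < b - alpha * a ->
    (forall n : nat, (S n `<=` S n.+1)%fset) ->
    (forall n : nat, (#|` S n|)%:R <= 2 `^ (eta * n%:R) :> R) ->
  exists (Omega' : set Omega) (C : Omega -> R),
    [/\ measurable Omega', P Omega' = 1%E &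
      forall w : Omega, Omega' w ->
      forall (n : nat) (s : I), s \in S n ->
      forall u v : 'rV[R]_d, unit_cube R d u -> unit_cube R d v ->
        enorm (u - v) <= 2 ^- n ->
        mdist (X s u w) (X s v w) <= C w * enorm (u - v) `^ alpha].
Proof.
move=> alpha eta S /andP[alpha0 alphab] /andP[eta0 eta_lt] S_incr card_S.
have momentX (s : I) (u v : 'rV[R]_d) : unit_cube R d u -> unit_cube R d v ->
    (\int[P]_w (mdist (X s u w) (X s v w) `^ a)%:E
     <= (enorm (u - v) `^ (d%:R + b))%:E)%E.
  move=> uc vc; apply: le_trans (hX u v uc vc).
  by apply: ereal_sup_ubound; exists s => //; rewrite unlock.
have [Om [K [mO PO HK]]] :=
  dyadic_increments P X a b alpha eta S ha hb eta_lt dist_measurable momentX card_S.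
pose r : R := 2 `^ - alpha.
have r1 : r < 1 by apply: powR2_lt1; rewrite oppr_lt0.
have r0 : 0 <= r by exact: powR_ge0.
(* The last factor pays for replacing [2 ^- m] by [2 ^- m.+1], the dyadic lower
   bound on the distance; the middle one comes from [chaining]. *)
exists Om, (fun w => K w * (1 + 2 / (1 - r)) * 2 `^ alpha); split => // w wO.
have [K0 HKw] := HK w wO.
move=> n s sS u v uc vc uvn.
have [uv0|uv0] := eqVneq u v.
  rewrite uv0 mdistxx mulr_ge0 ?powR_ge0// !mulr_ge0 ?powR_ge0//.
  by rewrite addr_ge0// divr_ge0// subr_ge0 ltW.
have e0 : 0 < enorm (u - v).
  rewrite lt_neqAle enorm_ge0 andbT eq_sym; apply: contra uv0 => /eqP uv0.
  rewrite -subr_eq0; apply/eqP/rowP => i.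
  by have := coord_le_enorm (u - v) i; rewrite uv0 normr_le0 => /eqP ->; rewrite mxE.
have [m [nm mlt mle]] := dyadic_scale _ _ _ e0 uvn.
have S_mono k : (m <= k)%N -> s \in S k.
  move=> mk; have /fsubsetP : (S n `<=` S k)%fset.
    apply: (homo_leq (@fsubset_refl _) (fun y x z => @fsubset_trans _ y x z)) => //.
    exact: leq_trans nm mk.
  exact.
have := chaining (fun x => X s x w) (K w) r m (X_continuous s w) K0 r0 r1
  (fun k p q mk pk qk pq => HKw k s p q (S_mono k mk) pk qk pq) u v uc vc
  (fun i => le_trans (coord_le_enorm _ i) mle).
move=> /le_trans; apply.
rewrite mulrAC -!mulrA ler_wpM2l// ler_wpM2l ?addr_ge0 ?divr_ge0 ?subr_ge0 ?(ltW r1)//.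
have -> : r ^+ m = 2 `^ alpha * (2 ^- m.+1) `^ alpha.
  rewrite -powR2_invX -powRM ?invr_ge0 ?exprn_ge0//; congr (_ `^ _).
  by rewrite exprS invfM mulVKf.
rewrite ler_wpM2l ?powR_ge0//.
by apply: ge0_ler_powR; rewrite ?nnegrE ?(ltW alpha0) ?(ltW mlt) ?(ltW e0).
Qed.
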